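(* We have $b(n)=0$ for $n\le7$, and for $m\ge3$ $$\begin{cases} b(U_{m+2})=b\big([U_{m-1},V_{m-1},W_{m-1}]\big)+[\underbrace{1,\ldots,1}_{\frac{-t_{m+1}+5t_{m-1}+1}{2}},\underbrace{0,\ldots,0}_{\frac{t_{m+1}-3t_{m-1}-1}{2}}];\\[2mm] b(V_{m+1})=b\big([U_{m-1},V_{m-1},W_{m-1}]\big)+[\underbrace{0,\ldots,0}_{\frac{t_{m-1}-t_{m-3}+1}{2}},\underbrace{1,\ldots,1}_{\frac{t_{m-1}+t_{m-3}-1}{2}}];\\[2mm] b(W_m)=b\big([U_{m-1},V_{m-1},W_{m-1}]\big)+[\underbrace{0,\ldots,0}_{\frac{t_{m-1}+t_{m-3}+1}{2}},\underbrace{1,\ldots,1}_{\frac{t_{m-1}-t_{m-3}-1}{2}}].\end{cases}$$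
   Context: The Tribonacci substitution $\sigma$ on the alphabet $\{a,b,c\}$ is $\sigma(a)=ab$, $\sigma(b)=ac$, $\sigma(c)=a$. The Tribonacci sequence $\mathbb{T}$ is the infinite word that is the fixed point of $\sigma$ beginning with $a$; $\mathbb{T}[1,n]$ is its prefix of length $n$. Put $T_{-2}=\epsilon$ (empty word), $T_{-1}=c$, $T_m=\sigma^m(a)$ for $m\ge0$, $t_m=|T_m|$ for $m\ge-2$, and $t_{-3}=0$; thus $t_{-3}=t_{-2}=0$, $t_{-1}=t_0=1$, $t_1=2$, $t_2=4$, $t_3=7$, $t_4=13$, and $t_m=t_{m-1}+t_{m-2}+t_{m-3}$ for $m\ge1$. For a non-empty factor $\omega$ of $\mathbb{T}$ and $p\ge1$, $\omega_p$ is the position in $\mathbb{T}$ of the last letter of the $p$-th occurrence of $\omega$. Write $\nu\triangleright\omega$ if $\nu$ is a suffix of $\omega$. Let $B(n)=\#\{(\omega,p)\mid\omega\text{ non-empty},\ p\ge1,\ \omega\omega\triangleright\mathbb{T}[1,\omega_{p+1}],\ \omega_{p+1}\le n\}$ for $n\ge0$ (number of repeated squares in $\mathbb{T}[1,n]$) and $b(n)=B(n)-B(n-1)$ for $n\ge1$. $[x..y]$ is the set of integers $\{x,\ldots,y\}$ (empty if $y<x$), and $[x..y]\oplus k=[x+k..y+k]$. For $m\ge0$ define $U_m=[1..t_{m-3}]\oplus\frac{t_{m+1}+t_{m-1}-3}{2}$, $V_m=[1..t_{m-2}]\oplus\frac{3t_m-t_{m-2}-3}{2}$, $W_m=[1..t_{m-1}]\oplus\frac{3t_m+t_{m-2}-3}{2}$.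 These are consecutive intervals, and $[U_m,V_m,W_m]$ denotes their union, an interval of $t_m$ integers. For an interval $[x..y]$ of positive integers, $b([x..y])$ denotes the vector $[b(x),b(x+1),\ldots,b(y)]$. Vectors of the same length are added entrywise; the number under a brace is the number of repeated entries. *)

(* Defs.v *)
From HB Require Import structures.
From mathcomp Require Import all_boot all_order all_algebra finmap.
From mathcomp Require Import boolp classical_sets functions cardinality.
From mathcomp Require Import zify ring.

Set Implicit Arguments.
Unset Strict Implicit.
Unset Printing Implicit Defensive.

Import Order.TTheory GRing.Theory Num.Theory.
Local Open Scope ring_scope.

Inductive letter := La | Lb | Lc.

Definition letter_code (x : letter) : nat :=
  match x with La => 0%N | Lb => 1%N | Lc => 2%N end.
Definition letter_decode (n : nat) : letter :=
  match n with 0%N => La | 1%N => Lb | _ => Lc end.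
Lemma letter_codeK : cancel letter_code letter_decode.
Proof. by case. Qed.
HB.instance Definition _ := Countable.copy letter (can_type letter_codeK).

Notation word := (seq letter).

Definition sigma_letter (x : letter) : word :=
  match x with La => [:: La; Lb] | Lb => [:: La; Lc] | Lc => [:: La] end.
Definition sigma (w : word) : word := flatten (map sigma_letter w).

(* Indices run over int because the words start at T_{-2}; extending T by the
   empty word at every index <= -2 gives the convention t_{-3} = 0. *)
Definition T (m : int) : word :=
  match m with
  | Posz n => iter n sigma [:: La]
  | Negz 0%N => [:: Lc]
  | Negz _ => [::]
  end.
Definition t (m : int) : int := (size (T m))%:Z.

(* T_k is a prefix of T_{k+1} and has more than k letters, so this is the limit
   of the words T_k.  Letters are numbered from 0 here: the letter of the
   Tribonacci sequence at position k >= 1 is trib k.-1. *)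
Definition trib (k : nat) : letter := nth La (T k%:Z) k.
Definition trib_prefix (n : nat) : word := mkseq trib n.

Lemma sigma_cat u v : sigma (u ++ v) = sigma u ++ sigma v.
Proof. by rewrite /sigma map_cat flatten_cat. Qed.

Lemma T_prefixS n : exists v, T n.+1%:Z = T n%:Z ++ v.
Proof.
elim: n => [|n [v IH]]; first by exists [:: Lb].
by exists (sigma v); rewrite -sigma_cat -IH.
Qed.

Lemma T_prefix n d : exists v, T (n + d)%N%:Z = T n%:Z ++ v.
Proof.
elim: d => [|d [v IH]]; first by exists [::]; rewrite addn0 cats0.
have [u Hu] := T_prefixS (n + d).
by exists (v ++ u); rewrite addnS Hu IH catA.
Qed.

Lemma size_sigma u : (size u <= size (sigma u))%N.
Proof. by elim: u => [|[] u IH] //=; rewrite -/(sigma u); lia. Qed.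

Lemma size_T n : (n < size (T n%:Z))%N.
Proof.
have H0 m : exists u, T m%:Z = La :: u.
  by have [u Hu] := T_prefix 0 m; exists u; rewrite -[m]add0n Hu.
elim: n => // n IH; have [u Hu] := H0 n.
have -> : T n.+1%:Z = sigma (T n%:Z) by [].
by move: IH; rewrite Hu /= -/(sigma u); have := size_sigma u; lia.
Qed.

Lemma nth_T n k : (k < size (T n%:Z))%N -> nth La (T n%:Z) k = trib k.
Proof.
move=> kn; rewrite /trib; case: (leqP k n) => le.
  have [u Hu] := T_prefix k (n - k).
  by rewrite -(subnKC le) Hu nth_cat size_T.
have [u Hu] := T_prefix n (k - n).
by move: Hu; rewrite (subnKC (ltnW le)) => ->; rewrite nth_cat kn.
Qed.

Lemma trib_prefix_T n : trib_prefix (size (T n%:Z)) = T n%:Z.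
Proof.
apply: (@eq_from_nth _ La); rewrite size_mkseq // => k kn.
by rewrite nth_mkseq // nth_T.
Qed.

Definition sigma_fixed (x : nat -> letter) : Prop :=
  forall n, prefix (sigma (mkseq x n)) (mkseq x (size (sigma (mkseq x n)))).

Lemma mkseqE (x : nat -> letter) n d :
  mkseq x (n + d) = mkseq x n ++ map x (iota n d).
Proof. by rewrite /mkseq iotaD map_cat. Qed.

Lemma trib_fixed : trib 0 = La /\ sigma_fixed trib.
Proof.
split=> // n; set w := mkseq trib n.
have [v Hv] : exists v, T n%:Z = w ++ v.
  rewrite -trib_prefix_T -(subnKC (ltnW (size_T n))) /trib_prefix mkseqE.
  by eexists.
have E : T n.+1%:Z = sigma w ++ sigma v.
  by rewrite -sigma_cat -Hv.
have := trib_prefix_T n.+1; rewrite E size_cat /trib_prefix mkseqE.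
move=> /eqP; rewrite eqseq_cat ?size_mkseq // => /andP[/eqP-> _].
exact: prefix_refl.
Qed.

Lemma trib_unique (x : nat -> letter) : x 0 = La -> sigma_fixed x -> x =1 trib.
Proof.
move=> x0 fx.
have xT n : mkseq x (size (T n%:Z)) = T n%:Z.
  elim: n => [|n IH]; first by rewrite /mkseq /= x0.
  have := fx (size (T n%:Z)); rewrite IH -[sigma _]/(T n.+1%:Z) prefixE.
  by rewrite take_oversize ?size_mkseq // => /eqP.
by move=> k; rewrite /trib -xT nth_mkseq // size_T.
Qed.

Definition ends_at (w : word) (k : nat) : bool := suffix w (trib_prefix k).

(* occ_pos w p k says that w_p = k, for non-empty w. *)
Definition occ_pos (w : word) (p k : nat) : bool :=
  ends_at w k && (count (ends_at w) (iota 1 k) == p).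

Definition repeated_squares (n : int) : set (word * nat) :=
  [set wp | [/\ wp.1 <> [::], (1 <= wp.2)%N &
     exists k : nat, [/\ occ_pos wp.1 wp.2.+1 k,
                         suffix (wp.1 ++ wp.1) (trib_prefix k) &
                         k%:Z <= n]]]%classic.

(* fset_set sends infinite sets to fset0, so the next lemma is what makes
   B n the number of elements of repeated_squares n. *)
Lemma finite_repeated_squares n : finite_set (repeated_squares n).
Proof.
pose N := `|n|%N; pose r := iota 0 N.+1.
pose l := [seq (w, p) | w <- [seq drop i (trib_prefix k) | i <- r, k <- r],
                        p <- r].
apply: (@sub_finite_set _ _ [set` l]%classic); last exact: finite_seq.
move=> [w p] [/= w0 p1 [k [/andP[wk /eqP cp] _ kn]]].
have kN : (k <= N)%N by rewrite /N; lia.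
have pk : (p < k)%N by rewrite -cp -[X in (_ <= X)%N](size_iota 1 k) count_size.
move: wk; rewrite /ends_at suffixE size_mkseq => /eqP wE.
have mem j : (j <= N)%N -> j \in r by rewrite mem_iota.
apply: (allpairs_f pair); last by apply: mem; lia.
rewrite -wE; apply: (allpairs_f (fun i k => drop i (trib_prefix k))).
  by apply: mem; lia.
exact: mem.
Qed.

Definition B (n : int) : int := (#|` fset_set (repeated_squares n)|)%:Z.
Definition b (n : int) : int := B n - B (n - 1).

Definition interval (x y : int) : seq int :=
  if x <= y then [seq x + i%:Z | i <- iota 0 (absz (y - x + 1))] else [::].
Definition shift (I : seq int) (k : int) : seq int := [seq x + k | x <- I].

(* The three halves below are exact for m >= 0: consecutive t's of index
   differing by 2 have opposite parity. *)
Definition U (m : int) : seq int :=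
  shift (interval 1 (t (m - 3))) ((t (m + 1) + t (m - 1) - 3) %/ 2)%Z.
Definition V (m : int) : seq int :=
  shift (interval 1 (t (m - 2))) ((3 * t m - t (m - 2) - 3) %/ 2)%Z.
Definition W (m : int) : seq int :=
  shift (interval 1 (t (m - 1))) ((3 * t m + t (m - 2) - 3) %/ 2)%Z.
Definition UVW (m : int) : seq int := U m ++ V m ++ W m.

Lemma T_rec n : T n.+2%:Z = T n.+1%:Z ++ T n%:Z ++ T (n%:Z - 1).
Proof.
elim: n => [|n IH]; first by [].
have TS k : T k.+1%:Z = sigma (T k%:Z) by [].
rewrite TS IH !sigma_cat -!TS; congr (_ ++ (_ ++ _)); first exact: IH.
case: n {IH} => [|n]; first by [].
have -> : n.+2%:Z - 1 = n.+1%:Z by lia.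
by have -> : n.+1%:Z - 1 = n%:Z by lia.
Qed.

Lemma t_rec m : 1 <= m -> t m = t (m - 1) + t (m - 2) + t (m - 3).
Proof.
case: m => [[|[|n]]|] // _.
have -> : n.+2%:Z - 1 = n.+1%:Z by lia.
have -> : n.+2%:Z - 2 = n%:Z by lia.
have -> : n.+2%:Z - 3 = n%:Z - 1 by lia.
by rewrite /t T_rec !size_cat; lia.
Qed.

Lemma shift_interval (n : nat) (k : int) :
  shift (interval 1 n%:Z) k = [seq k + 1 + i%:Z | i <- iota 0 n].
Proof.
rewrite /shift /interval; case: ifP => [n1|/negP n1].
  have -> : absz (n%:Z - 1 + 1) = n by lia.
  by rewrite -map_comp; apply: eq_map => i /=; lia.
by have -> : n = 0%N by lia.
Qed.

Lemma shift_interval_cat (p q : nat) (k : int) :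
  shift (interval 1 p%:Z) k ++ shift (interval 1 q%:Z) (k + p%:Z) =
  shift (interval 1 (p%:Z + q%:Z)) k.
Proof.
rewrite -PoszD !shift_interval iotaD map_cat add0n; congr (_ ++ _).
rewrite -[X in _ = map _ (iota X _)]addn0 iotaDl -map_comp.
by apply: eq_map => i /=; lia.
Qed.

(* The three intervals are consecutive, so UVW m lists their union, an interval
   of t_m integers, in increasing order. *)
Lemma UVW_interval m : 0 <= m ->
  UVW m = shift (interval 1 (t m)) ((t (m + 1) + t (m - 1) - 3) %/ 2)%Z.
Proof.
move=> m0; have r1 : t (m + 1) = t m + t (m - 1) + t (m - 2).
  rewrite t_rec; last by lia.
  by congr (t _ + t _ + t _); lia.
have r0 : t m = t (m - 3) + t (m - 2) + t (m - 1).
  case: m m0 {r1} => [[|n]|] _ //.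
  by rewrite [LHS]t_rec // addrC addrA addrAC.
have half2 (a c n : int) : a = n * 2 + c -> (a %/ 2)%Z = (c %/ 2)%Z + n.
  by move=> ->; rewrite divzMDl // addrC.
rewrite /UVW /U /V /W; set k := (_ %/ 2)%Z.
have -> : ((3 * t m - t (m - 2) - 3) %/ 2)%Z = k + t (m - 3).
  by apply: half2; rewrite r1 r0; ring.
have -> : ((3 * t m + t (m - 2) - 3) %/ 2)%Z = k + (t (m - 3) + t (m - 2)).
  by apply: half2; rewrite r1 r0; ring.
by rewrite [in RHS]r0 catA shift_interval_cat -PoszD shift_interval_cat.
Qed.

Definition bvec (I : seq int) : seq int := map b I.

(* zip truncates to the shorter vector and absz ignores signs.  Neither is felt
   in the statement: for m >= 3 the repetition counts there are non-negative
   integers (the halves being exact) and every vector has length t_{m-1}. *)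
Definition vadd (u v : seq int) : seq int := [seq x.1 + x.2 | x <- zip u v].
Definition rep (k : int) (x : int) : seq int := nseq `|k|%N x.

(* Main.v *)
(* b(n) counts the squares ending at position n.  With P_m the last position
   before U_m, the three identities say that, for P_{m-1} < n <= P_m and
   M = m, m+1, m+2, b(n + t_M) = b(n) + 1 or b(n) according to n.  The prefix
   of length P_M recurs at position t_M, so the squares ending at n + t_M that
   start after position t_M are those ending at n; what remains is to find the
   squares ending at n + t_M that start earlier.  These are obtained by
   desubstitution: sigma maps maximal runs to maximal runs (an image gains one
   letter on the right), and every square of period at least 2 comes from a run
   one level lower.  By induction only five families of runs occur in the
   relevant window, and comparing their end points with n gives the result. *)
Require Import Defs.
From mathcomp Require Import all_boot all_order all_algebra finmap.
From mathcomp Require Import boolp classical_sets cardinality.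
From mathcomp Require Import zify.

Set Implicit Arguments.
Unset Strict Implicit.
Unset Printing Implicit Defensive.

Import Order.TTheory GRing.Theory Num.Theory.
Local Open Scope nat_scope.

(** * Block decomposition of the Tribonacci word *)

(** Counted from 0, the position where the block that is the image of letter number [k] begins. *)
Definition tribpos (k : nat) : nat := size (sigma (trib_prefix k)).

(* [next_letter x] is both the last letter of [sigma x] and the letter that
   follows the initial a in [sigma x] a. *)
Definition next_letter (x : letter) : letter :=
  match x with La => Lb | Lb => Lc | Lc => La end.

Lemma next_letter_inj : injective next_letter.
Proof. by case; case. Qed.

Lemma trib_prefixS k : trib_prefix k.+1 = rcons (trib_prefix k) (trib k).
Proof. by rewrite /trib_prefix mkseqS. Qed.

Lemma sigma_prefix k : sigma (trib_prefix k) = trib_prefix (tribpos k).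
Proof.
have [_ /(_ k)] := trib_fixed; rewrite prefixE => /eqP <-.
by rewrite take_oversize // size_mkseq.
Qed.

Lemma tribpos0 : tribpos 0 = 0. Proof. by []. Qed.

Lemma tribposS k : tribpos k.+1 = tribpos k + size (sigma_letter (trib k)).
Proof. by rewrite /tribpos trib_prefixS -cats1 sigma_cat size_cat /sigma /= cats0. Qed.

Lemma trib_tribpos_add k d : d < size (sigma_letter (trib k)) ->
  trib (tribpos k + d) = nth La (sigma_letter (trib k)) d.
Proof.
move=> dk; have := sigma_prefix k.+1.
rewrite {1}trib_prefixS -cats1 sigma_cat /sigma /= cats0 -/(sigma _).
move=> /(congr1 (fun u => nth La u (tribpos k + d))).
rewrite nth_cat -/(tribpos k) ltnNge leq_addr /= addKn => ->.
by rewrite nth_mkseq // tribposS ltn_add2l.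
Qed.

Lemma trib_tribpos k : trib (tribpos k) = La.
Proof. by rewrite -[tribpos k]addn0 trib_tribpos_add; case: (trib k). Qed.

Lemma trib_tribpos_succ k : trib (tribpos k).+1 = next_letter (trib k).
Proof.
case E: (trib k); try by rewrite -addn1 trib_tribpos_add E.
by have := tribposS k; rewrite E /= addn1 => <-; rewrite trib_tribpos.
Qed.

Lemma trib_tribpos_pred k : trib (tribpos k.+1).-1 = next_letter (trib k).
Proof.
by rewrite tribposS; case E: (trib k); rewrite /= ?addn2 ?addn1 /=;
  rewrite ?trib_tribpos_succ ?trib_tribpos ?E.
Qed.

Lemma tribposS_bounds k : tribpos k < tribpos k.+1 <= (tribpos k).+2.
Proof. by rewrite tribposS; case: (trib k) => /=; lia. Qed.

Lemma tribpos_lt : {mono tribpos : i j / i < j}.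
Proof.
apply: leqW_mono; apply: leq_mono; apply: homo_ltn; first exact: ltn_trans.
by move=> i; case/andP: (tribposS_bounds i).
Qed.

Lemma tribpos_le : {mono tribpos : i j / i <= j}.
Proof. by move=> i j; rewrite leqNgt tribpos_lt -leqNgt. Qed.

(** Blocks have one or two letters, so a position either begins a block or is the second and last
    letter of one. *)
Lemma tribpos_cover n : exists k, n = tribpos k \/
  n = (tribpos k).+1 /\ tribpos k.+1 = n.+1.
Proof.
elim: n => [|n [k [->|[_ <-]]]]; first by exists 0; left.
  have /andP[l1 l2] := tribposS_bounds k.
  case: (eqVneq (tribpos k.+1) (tribpos k).+1) => [<-|ne].
    by exists k.+1; left.
  by exists k; right; split=> //; lia.
by exists k.+1; left.
Qed.

Lemma trib_eqLa n : trib n = La -> exists k, n = tribpos k.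
Proof.
case: (tribpos_cover n) => k [->|[E Sk]] a; first by exists k.
move: a Sk; rewrite E trib_tribpos_succ tribposS.
by case: (trib k) => //= _; lia.
Qed.

Lemma trib_neqLa n : trib n <> La -> exists k, n = (tribpos k).+1.
Proof.
case: (tribpos_cover n) => k [->|[-> _] _]; first by rewrite trib_tribpos.
by exists k.
Qed.

(* This is where cc not being a factor enters. *)
Lemma tribposSS k : (tribpos k).+3 <= tribpos k.+2.
Proof.
have ccP n : trib n = Lc -> trib n.+1 = La.
  case: (tribpos_cover n) => i [->|[_ <-] _]; first by rewrite trib_tribpos.
  exact: trib_tribpos.
by rewrite !tribposS; case E: (trib k); rewrite ?(ccP _ E) /=;
  case: (trib k.+1) => /=; lia.
Qed.

(** * Repetitions under the substitution and their desubstitution *)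

Definition agree (i j n : nat) : Prop :=
  forall d, d < n -> trib (i + d) = trib (j + d).

Lemma agree_tribpos i j n d : agree i j n -> d <= n ->
  tribpos (i + d) + tribpos j = tribpos (j + d) + tribpos i.
Proof.
move=> ag; elim: d => [|d IH] dn; first by rewrite !addn0 addnC.
have := IH (ltnW dn); rewrite !addnS !tribposS (ag d dn); lia.
Qed.

(* Distinct letters have images ending in distinct letters, while images
   followed by the next block have exactly one letter in common: an
   agreement extends by one letter to the right and by none to the left. *)
Lemma agree_sigma i j n : agree i j n ->
  agree (tribpos i) (tribpos j) (tribpos (i + n) - tribpos i).+1.
Proof.
move=> ag d dn.
have in_le : tribpos i <= tribpos (i + n) by rewrite tribpos_le leq_addr.
have [k Hk] := tribpos_cover (tribpos i + d).
have ik : i <= k.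
  rewrite -ltnS -tribpos_lt; have /andP[] := tribposS_bounds k; case: Hk; lia.
have kn : k <= i + n by rewrite -tribpos_le; case: Hk; lia.
have := @agree_tribpos i j n (k - i) ag; rewrite subnKC // => E.
have {}E : tribpos j + (tribpos k - tribpos i) = tribpos (j + (k - i)).
  have: tribpos i <= tribpos k by rewrite tribpos_le.
  by have := E ltac:(lia); lia.
have ik' : tribpos i <= tribpos k by rewrite tribpos_le.
case: Hk => [dE|[dE Sk]].
  rewrite dE trib_tribpos; have -> : d = tribpos k - tribpos i by lia.
  by rewrite E trib_tribpos.
rewrite dE; have -> : d = (tribpos k - tribpos i).+1 by lia.
rewrite addnS E !trib_tribpos_succ; congr next_letter.
have kn' : k < i + n by rewrite -tribpos_lt; lia.
by have := ag (k - i) ltac:(lia); rewrite subnKC.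
Qed.

(** The letter after the initial a of a block determines the block, so the two halves are compared
    block by block. The last block is lost: the letter after its initial a lies beyond the
    agreement. *)
Lemma near_square_block z l k : 1 < l ->
  agree (tribpos z) (tribpos z + l) l.-1 -> tribpos z + l = tribpos k ->
  z < k /\ agree z k (k - z).-1.
Proof.
move=> l1 ag kE; have zk : z < k by rewrite -tribpos_lt; lia.
split=> //.
suff H d : d <= (k - z).-1 -> tribpos (z + d) + l = tribpos (k + d) /\
    agree z k d by have [] := H _ (leqnn _).
elim: d => [|d IH] dk; first by rewrite !addn0; split.
have [pE agd] := IH (ltnW dk).
(* At least two blocks from number [z + d] on precede block [k]; having at least three letters, they
   keep the tested letter inside the agreement. *)
have dlt : (tribpos (z + d)).+1 < tribpos z + l.-1.
  have := tribposSS (z + d).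
  have : tribpos (z + d).+2 <= tribpos k by rewrite tribpos_le; lia.
  lia.
have zd : tribpos z <= tribpos (z + d) by rewrite tribpos_le leq_addr.
have e : trib (z + d) = trib (k + d).
  apply: next_letter_inj; rewrite -!trib_tribpos_succ -pE.
  have := ag ((tribpos (z + d)).+1 - tribpos z) ltac:(lia).
  by rewrite subnKC ?(leqW zd) // => ->; congr trib; lia.
split; first by rewrite !addnS !tribposS e; lia.
by move=> d'; rewrite ltnS leq_eqVlt => /predU1P[->|/agd].
Qed.

(** Block starts are exactly the letters a, so both halves begin at the same offset [d] of a block,
    read off from their common first letter. *)
Lemma near_square_desubstitution z l : 1 < l -> agree z (z + l) l.-1 ->
  exists z' l' d, [/\ d <= 1, 0 < l', z = tribpos z' + d,
    z + l = tribpos (z' + l') + d & agree z' (z' + l') l'.-1].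
Proof.
move=> l1 ag; have z0 : trib z = trib (z + l).
  by have := ag 0; rewrite !addn0; apply; lia.
have fin z' k : agree (tribpos z') (tribpos z' + l) l.-1 ->
    tribpos z' + l = tribpos k ->
    exists l', [/\ 0 < l', k = z' + l' & agree z' (z' + l') l'.-1].
  move=> a kE; have [lt ag'] := near_square_block l1 a kE.
  by exists (k - z'); rewrite subnKC ?(ltnW lt) //; split=> //; lia.
case: (tribpos_cover z) => z' [zE|[zE Sz]].
  have [k kE] : exists k, z + l = tribpos k.
    by apply: trib_eqLa; rewrite -z0 zE trib_tribpos.
  have [||l' [l'0 kl ag']] := fin z' k; rewrite -?zE //.
  by exists z', l', 0; rewrite !addn0 -kl; split=> //; rewrite kl.
have nz : trib z <> La.
  move: Sz; rewrite zE trib_tribpos_succ tribposS.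
  by case: (trib z') => //=; lia.
have [k kE] : exists k, z + l = (tribpos k).+1.
  by apply: trib_neqLa; rewrite -z0.
have kE' : tribpos z' + l = tribpos k by lia.
have [|//|l' [l'0 kl ag']] := fin z' k.
  (* Moving back one letter, to the initial a of both blocks, preserves an agreement of length l -
     1. *)
  move=> [|d] dl; first by rewrite !addn0 kE' !trib_tribpos.
  by have := ag d ltac:(lia); rewrite zE !addSn !addnS.
by exists z', l', 1; rewrite -kl !addn1; split=> //; rewrite kl.
Qed.

(* The factor on [i, i + l + n) has period l and extends in neither direction. *)
Definition maxrun (i n l : nat) : Prop :=
  [/\ agree i (i + l) n, trib (i + n) <> trib (i + l + n)
    & 0 < i -> trib i.-1 <> trib (i + l).-1].

(** Both ends stay maximal: the letters adjoining the image are the [next_letter] values of those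
    adjoining the run, and [next_letter] is injective. *)
Lemma maxrun_sigma i n l : maxrun i n l ->
  maxrun (tribpos i) (tribpos (i + n) - tribpos i).+1
    (tribpos (i + l) - tribpos i).
Proof.
case=> ag br bl; have il : tribpos i <= tribpos (i + l).
  by rewrite tribpos_le leq_addr.
have ni : tribpos i <= tribpos (i + n) by rewrite tribpos_le leq_addr.
split; rewrite subnKC //; first exact: agree_sigma.
  rewrite addnS subnKC // trib_tribpos_succ.
  have -> : tribpos (i + l) + (tribpos (i + n) - tribpos i).+1 =
      (tribpos (i + l + n)).+1.
    by have := agree_tribpos ag (leqnn n); lia.
  by rewrite trib_tribpos_succ => /next_letter_inj.
case: i {ag br il ni} bl => [|i] bl i0; first by rewrite tribpos0 in i0.
by rewrite addSn !trib_tribpos_pred => /next_letter_inj; apply: bl.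
Qed.

(** * The lengths t_n and P_n, and the run at the origin *)

Definition tlen (n : nat) : nat := size (T n%:Z).

Lemma tlenSSS n : tlen n.+3 = tlen n.+2 + tlen n.+1 + tlen n.
Proof.
rewrite /tlen (T_rec n.+1) !size_cat addnA.
by have -> : (n.+1%:Z - 1 = n%:Z)%R by lia.
Qed.

Lemma tlen_bounds n : 0 < tlen n <= tlen n.+1 /\ tlen n.+1 <= 2 * tlen n.
Proof.
suff: [/\ 0 < tlen n <= tlen n.+1, tlen n.+1 <= 2 * tlen n,
   tlen n.+1 + tlen n <= tlen n.+2 & tlen n.+2 <= 2 * tlen n.+1] by case.
by elim: n => [//|n [? ? ? ?]]; rewrite tlenSSS; split; lia.
Qed.

Lemma tribpos_tlen n : tribpos (tlen n) = tlen n.+1.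
Proof. by rewrite /tribpos /tlen trib_prefix_T. Qed.

(* The number P_m = (t_{m+1} + t_{m-1} - 3) / 2 preceding the block U_m. *)
Fixpoint plen (n : nat) : nat := if n is m.+1 then plen m + tlen m else 0.
Arguments plen : simpl never.

Lemma plenS n : plen n.+1 = plen n + tlen n. Proof. by []. Qed.

(** The closed form of P_n, since t_{n+2} - t_n = t_{n+1} + t_{n-1}. *)
Lemma plen_tlen n : 2 * plen n + 3 + tlen n = tlen n.+2.
Proof.
by elim: n => // n IH; rewrite plenS tlenSSS; move: IH; lia.
Qed.

(** The two facts need each other: the first gives the length of the image run, and the recurrence
    of the prefix at t_n gives the first one level higher. *)
Lemma tribpos_plen_run n :
  (tribpos (plen n)).+1 = plen n.+1 /\ maxrun 0 (plen n) (tlen n).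
Proof.
elim: n => [|n [E run]]; first by split.
have run' := maxrun_sigma run.
rewrite tribpos0 !add0n !subn0 E tribpos_tlen in run'; split=> //.
have [ag _ _] := run; have := agree_tribpos ag (leqnn (plen n)).
rewrite !add0n tribpos0 tribpos_tlen => H.
have E' : plen n.+1 = tlen n + plen n by rewrite plenS addnC.
by rewrite (plenS n.+1) {1}E' -E; lia.
Qed.

Lemma tribpos_plen n : (tribpos (plen n)).+1 = plen n.+1.
Proof. by have [] := tribpos_plen_run n. Qed.

Lemma trib_tlen_add n k : k < plen n -> trib (tlen n + k) = trib k.
Proof. by have [_ [ag _ _]] := tribpos_plen_run n; move/ag; rewrite !add0n. Qed.

Lemma tribpos_tlen_add n k : k <= plen n ->
  tribpos (tlen n + k) = tlen n.+1 + tribpos k.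
Proof.
have [_ [ag _ _]] := tribpos_plen_run n => kn.
by have := agree_tribpos ag kn; rewrite !add0n tribpos0 tribpos_tlen; lia.
Qed.

(** * The five families of runs *)

Definition run_sigma (r : nat * nat * nat) : nat * nat * nat :=
  let: (i, n, l) := r in
  (tribpos i, (tribpos (i + n) - tribpos i).+1, tribpos (i + l) - tribpos i).

(* The maximal runs (start, overlap length, period), for M = q + 3, containing
   a near square that starts before t_M and ends between t_M + P_{M-3} and
   t_M + P_M + 2; the second and the third run contain no square ending beyond
   t_M + P_{M-3}. *)
Definition early_runs (q : nat) : seq (nat * nat * nat) :=
  [:: (0, plen q.+3, tlen q.+3); (0, plen q.+2, tlen q.+2);
      (tlen q.+2, plen q.+1, tlen q.+1);
      (tlen q.+2, plen q.+2, tlen q.+1 + tlen q);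
      (tlen q.+2 + tlen q.+1, plen q.+1, tlen q)].

(** Every start, and every start plus period, is 0, t_k or t_{k+1} + t_k, so [tribpos] just raises
    indices. Each end is P_k or t_j + P_k, and the letter gained on the right turns [tribpos] of P_k
    into P_{k+1}. *)
Lemma early_runs_sigma q :
  map run_sigma (early_runs q) = early_runs q.+1.
Proof.
have tp n : tlen n <= plen n.+1 by rewrite plenS leq_addl.
have pp n : plen n <= plen n.+1 by rewrite plenS leq_addr.
rewrite /early_runs /= !add0n !subn0 !tribpos_tlen.
have -> : tlen q.+2 + tlen q.+1 + plen q.+1 = tlen q.+2 + plen q.+2.
  by rewrite [plen q.+2]plenS; lia.
have E : tlen q.+2 + (tlen q.+1 + tlen q) = tlen q.+3 by rewrite tlenSSS addnA.
rewrite -(tlenSSS q) E !tribpos_tlen_add ?tribpos_tlen // tribpos0.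
have := (tlenSSS q.+1, plenS q.+3, plenS q.+2, plenS q.+1).
rewrite -!tribpos_plen => -[[[h1 h2] h3] h4].
by congr [:: (_, _, _); (_, _, _); (_, _, _); (_, _, _); (_, _, _)]; lia.
Qed.

(** As 81 = t_7, base cases can be computed on T_7. *)
Lemma trib_lt81 k : k < 81 -> trib k = nth La (T 7%:Z) k.
Proof. by move=> k81; rewrite nth_T. Qed.

Lemma early_runs_maxrun q i n l :
  1 < q -> (i, n, l) \in early_runs q -> maxrun i n l.
Proof.
case: q => [|[|q]] // _; elim: q i n l => [|q IH] i n l.
  pose f := nth La (T 7%:Z).
  pose ok r := let: (i, n, l) := r in
    [&& i + l + n < 81, all (fun d => f (i + d) == f (i + l + d)) (iota 0 n),
      f (i + n) != f (i + l + n) & (0 < i) ==> (f i.-1 != f (i + l).-1)].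
  have /allP H : all ok (early_runs 2) by vm_compute.
  move=> /H /and4P[lt /allP ag /eqP br /implyP bl]; split.
  - move=> d dn; rewrite !trib_lt81; try lia.
    by apply/eqP/ag; rewrite mem_iota.
  - by rewrite !trib_lt81; try lia.
  - by move=> /bl /eqP; rewrite !trib_lt81; try lia.
rewrite -early_runs_sigma => /mapP[[[i' n'] l'] /IH run [-> -> ->]].
exact: maxrun_sigma.
Qed.

(* Near squares rather than squares, because the image of u u with its last
   letter deleted may be a square. *)
Lemma early_near_squares q z l : 1 < q -> z < tlen q.+3 ->
  tlen q.+3 + plen q <= z + l + l <= tlen q.+3 + plen q.+3 + 2 ->
  agree z (z + l) l.-1 ->
  exists i n, (i, n, l) \in early_runs q /\ i <= z <= i + n.
Proof.
case: q => [|[|q]] // _; elim: q z l => [|q IH] z l zt /andP[lo hi] ag.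
  pose f := nth La (T 7%:Z).
  pose ns z l := all (fun d => f (z + d) == f (z + l + d)) (iota 0 l.-1).
  (* Here 24 = t_5, 27 = t_5 + P_2 and 53 = t_5 + P_5 + 2; the last also forces l < 27. *)
  have : all (fun z => all (fun l => (27 <= z + l + l <= 53) ==> ns z l ==>
    has (fun r => (r.2 == l) && (r.1.1 <= z <= r.1.1 + r.1.2)) (early_runs 2))
    (iota 0 27)) (iota 0 24) by vm_compute.
  move: zt lo hi; rewrite -[tlen 5]/24 -[plen 2]/3 -[plen 5]/27.
  rewrite -[24 + 3]/27 -[24 + 27 + 2]/53 => zt lo hi.
  move=> /allP/(_ z); rewrite mem_iota => /(_ zt) /allP/(_ l).
  rewrite mem_iota add0n leq0n => /(_ ltac:(lia)).
  rewrite lo hi => /implyP/(_ isT)/implyP H.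
  have /H /hasP[[[i n] l'] mem /andP[/eqP/= E iz]] : ns z l.
    apply/allP => d; rewrite mem_iota add0n => /= dl.
    by have := ag d dl; rewrite !trib_lt81; try lia; move=> E; exact/eqP.
  by exists i, n; rewrite -E.
have tb := tlen_bounds q.+4.+1; have tb' := tlen_bounds q.+4.
have l1 : 1 < l.
  have : 2 < plen q.+3 by rewrite !plenS; have := plen_tlen q; have := tlen_bounds q;
   have := tlen_bounds q.+1; have := tlen_bounds q.+2; have := tlenSSS q; lia.
  lia.
have [z' [l' [d [d1 l'0 zE zlE ag']]]] := near_square_desubstitution l1 ag.
have ts k (kle : k <= plen q.+4.+1) := tribpos_tlen_add kle.
have zt' : z' < tlen q.+4.+1 by rewrite -tribpos_lt tribpos_tlen; lia.
have shl : tribpos (z' + l' + l').-1 = tribpos (z' + l').-1 + l.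
  have := agree_tribpos ag' (leqnn _).
  have -> : z' + l'.-1 = (z' + l').-1 by lia.
  have -> : z' + l' + l'.-1 = (z' + l' + l').-1 by lia.
  by lia.
have /andP[s1 s2] : tribpos (z' + l').-1 < tribpos (z' + l') <=
    (tribpos (z' + l').-1).+2.
  by have := tribposS_bounds (z' + l').-1; rewrite prednK // addn_gt0 l'0 orbT.
have pp := tribpos_plen.
have p52 : plen q.+2 <= plen q.+4.+1 by rewrite !plenS; lia.
have t52 := ts _ p52; have t55 := ts _ (leqnn _).
have p2 := pp q.+2; have p5 := pp q.+4.+1.
(* Both bounds descend by contradiction: two consecutive blocks have at least 3 letters, while
   [tribpos] of P_k is P_{k+1} - 1. So the slack 2 in the upper bound reproduces itself as 3 - 1. *)
have [|i' [n' [mem /andP[iz zn]]]] := IH z' l' zt' _ ag'.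
  apply/andP; split.
    rewrite leqNgt; apply/negP => lt.
    have : tribpos ((z' + l' + l').-1).+2 <= tribpos (tlen q.+4.+1 + plen q.+2).
      by rewrite tribpos_le; lia.
    by have := tribposSS (z' + l' + l').-1; lia.
  rewrite leqNgt; apply/negP => lt.
  have : tribpos (tlen q.+4.+1 + plen q.+4.+1).+2 <= tribpos (z' + l' + l').-1.
    by rewrite tribpos_le; lia.
  by have := tribposSS (tlen q.+4.+1 + plen q.+4.+1); lia.
have [agr _ _] := early_runs_maxrun (isT : 1 < q.+2) mem.
(* Shifting by l' inside the run moves block starts by the same amount at z' and at i', so l is the
   period of the image run. *)
have lE : l = tribpos (i' + l') - tribpos i'.
  have := agree_tribpos agr (d := z' - i') ltac:(lia).
  by rewrite subnKC // addnAC subnKC //; lia.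
exists (tribpos i'), (tribpos (i' + n') - tribpos i').+1.
rewrite -early_runs_sigma lE; split; first exact: (map_f run_sigma mem).
have : tribpos i' <= tribpos z' by rewrite tribpos_le.
have : tribpos z' <= tribpos (i' + n') by rewrite tribpos_le.
lia.
Qed.

(** * Squares by end position and period; [b] as their count *)

(** The sequence is a parameter so that the test can be evaluated on a finite word. *)
Definition square_at (x : nat -> letter) (n l : nat) : bool :=
  [&& 0 < l, l + l <= n & all (fun d => x (n - l - l + d) == x (n - l + d)) (iota 0 l)].

Definition last_letters (n l : nat) : word := drop (n - l) (trib_prefix n).

Lemma size_last_letters n l : l <= n -> size (last_letters n l) = l.
Proof. by move=> ln; rewrite size_drop size_mkseq subKn. Qed.

Lemma nth_last_letters n l d : d < l -> l <= n ->
  nth La (last_letters n l) d = trib (n - l + d).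
Proof. by move=> dl ln; rewrite nth_drop nth_mkseq //; lia. Qed.

Lemma ends_atE (w : word) (n : nat) : ends_at w n -> w = last_letters n (size w).
Proof. by rewrite /ends_at suffixE size_mkseq => /eqP. Qed.

Lemma square_at_suffix n l : square_at trib n l ->
  suffix (last_letters n l ++ last_letters n l) (trib_prefix n).
Proof.
case/and3P => l0 ln /allP sq.
rewrite suffixE size_cat !size_last_letters ?size_mkseq; try lia.
apply/eqP/(@eq_from_nth _ La).
  by rewrite size_drop size_mkseq size_cat !size_last_letters; lia.
move=> d; rewrite size_drop size_mkseq => dn.
rewrite nth_cat size_last_letters; try lia.
rewrite nth_drop nth_mkseq; try lia.
case: ltnP => dl; rewrite nth_last_letters; try lia.
  by rewrite subnDA; apply/eqP/sq; rewrite mem_iota.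
by congr trib; lia.
Qed.

Lemma suffix_square_at (w : word) (n : nat) : w <> [::] -> suffix (w ++ w) (trib_prefix n) ->
  square_at trib n (size w).
Proof.
move=> w0 /suffixP [u E].
have sz : n = size u + (size w + size w) by rewrite -!size_cat -E size_mkseq.
apply/and3P; split; [by case: (w) w0 | by lia |].
apply/allP => d; rewrite mem_iota add0n => /= dw; apply/eqP.
have N k : k < n -> trib k = nth La (u ++ w ++ w) k.
  by move=> kn; rewrite -E nth_mkseq.
have [d1 d2] : n - size w - size w + d < n /\ n - size w + d < n by split; lia.
rewrite !N // !nth_cat.
have -> : n - size w - size w + d < size u = false by lia.
have -> : n - size w + d < size u = false by lia.
have -> : n - size w - size w + d - size u = d by lia.
have -> : n - size w + d - size u = size w + d by lia.
have -> : (d < size w) = true by lia.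
have -> : size w + d < size w = false by lia.
by have -> : size w + d - size w = d by lia.
Qed.

Lemma occ_pos_inj w p k k' : occ_pos w p k -> occ_pos w p k' -> k = k'.
Proof.
have lt i j : i < j -> occ_pos w p i -> ~ occ_pos w p j.
  move=> ij /andP[_ /eqP ci] /andP[ej /eqP].
  have -> : iota 1 j = iota 1 i ++ iota i.+1 (j - i).-1 ++ [:: j].
    have {1}-> : j = i + ((j - i).-1 + 1) by lia.
    by rewrite !iotaD add1n /=; do 2 congr (_ ++ _); congr [:: _]; lia.
  by rewrite !count_cat ci /= ej; lia.
by move=> ok ok'; case: (ltngtP k k') => // [/lt/(_ ok)|/lt/(_ ok')].
Qed.

(** The two halves end at k - l and k, so at least two occurrences of [w] end by k. *)
Lemma square_at_occ k l (w := last_letters k l)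
    (p := (count (ends_at w) (iota 1 k)).-1) :
  square_at trib k l -> 0 < p /\ occ_pos w p.+1 k.
Proof.
move=> sq; have sf := square_at_suffix sq.
move: sq => /and3P[l0 lk _]; have [u E] := suffixP sf.
have szl : size w = l by rewrite size_last_letters //; lia.
have szu : size u + l = k - l.
  have := congr1 size E; rewrite size_mkseq !size_cat szl; lia.
have ek : ends_at w k by apply/suffixP; exists (u ++ w); rewrite -catA.
have ekl : ends_at w (k - l).
  apply/suffixP; exists u.
  have -> : trib_prefix (k - l) = take (k - l) (trib_prefix k).
    rewrite /trib_prefix /mkseq -map_take take_iota.
    by congr (map _ (iota _ _)); lia.
  by rewrite E catA take_size_cat // size_cat szl.
have two : 1 < count (ends_at w) (iota 1 k).
  have -> : k = (k - l).-1 + (1 + (l.-1 + 1)) by lia.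
  rewrite !iotaD !count_cat /=.
  have -> : 1 + (k - l).-1 = k - l by lia.
  have -> : k - l + 1 + l.-1 = k by lia.
  by rewrite !addn0 ekl ek; lia.
by rewrite /occ_pos ek /p; split; [|rewrite prednK //]; lia.
Qed.

Lemma mem_repeated_squares (n : nat) wp :
  repeated_squares n%:Z wp <->
  exists2 k, k <= n & exists2 l, square_at trib k l &
    wp = (last_letters k l, (count (ends_at (last_letters k l)) (iota 1 k)).-1).
Proof.
case: wp => w p; rewrite /repeated_squares /=; split.
  case=> w0 p0 [k [/andP[ek /eqP ck] sq kn]]; exists k; first by lia.
  exists (size w); first exact: suffix_square_at.
  by rewrite -(ends_atE ek) ck.
case=> k kn [l sq [-> ->]]; have [p0 occ] := square_at_occ sq.
split=> //; last by exists k; split=> //; exact: square_at_suffix.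
case/and3P: sq => l0 lk _ /(congr1 size).
by rewrite size_last_letters /=; lia.
Qed.

(** The new pairs are those of squares ending at n: their periods are the lengths of their words,
    and [occ_pos_inj] separates them from the pairs ending earlier. *)
Lemma b_count (n : nat) : 0 < n ->
  b n%:Z = (count (square_at trib n) (iota 1 n))%:Z%R.
Proof.
case: n => // n _; rewrite /b /B.
have -> : (n.+1%:Z - 1 = n%:Z)%R by lia.
pose f l := (last_letters n.+1 l,
  (count (ends_at (last_letters n.+1 l)) (iota 1 n.+1)).-1).
pose s := filter (square_at trib n.+1) (iota 1 n.+1).
have szs l : l \in s -> l <= n.+1.
  by rewrite mem_filter => /andP[/and3P[]]; lia.
have us : uniq (map f s).
  rewrite map_inj_in_uniq ?filter_uniq ?iota_uniq // => l l' /szs ls /szs ls'.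
  by case=> /(congr1 size); rewrite !size_last_letters.
have mem m wp : (wp \in fset_set (repeated_squares m%:Z)) =
    `[< repeated_squares m%:Z wp >].
  rewrite in_fset_set; last exact: finite_repeated_squares.
  by apply/idP/asboolP; rewrite in_setE.
have -> : fset_set (repeated_squares n.+1%:Z) =
    (fset_set (repeated_squares n%:Z) `|` [fset x in map f s])%fset.
  apply/fsetP => wp; rewrite in_fsetU in_fset /= !mem.
  apply/asboolP/orP => [/mem_repeated_squares [k kn [l sq E]]|].
    move: kn; rewrite leq_eqVlt => /predU1P[kE|kn]; last first.
      by left; apply/asboolP/mem_repeated_squares; exists k => //; exists l.
    subst k; right; rewrite E; apply/mapP; exists l => //.
    by rewrite mem_filter sq mem_iota; case/and3P: sq; lia.
  case=> [/asboolP/mem_repeated_squares [k kn [l sq E]]|/mapP[l]].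
    by apply/mem_repeated_squares; exists k; [lia|exists l].
  rewrite mem_filter => /andP[sq _] ->; apply/mem_repeated_squares.
  by exists n.+1 => //; exists l.
have dis : [disjoint fset_set (repeated_squares n%:Z) & [fset x in map f s]]%fset.
  apply/fdisjointP => wp; rewrite mem => /asboolP/mem_repeated_squares.
  case=> k kn [l sq ->]; rewrite in_fset; apply/negP => /= /mapP[l' ls' [ew ep]].
  have {ls'} sq' : square_at trib n.+1 l'.
    by move: ls'; rewrite mem_filter => /andP[].
  have [_ occ] := square_at_occ sq; have [_ occ'] := square_at_occ sq'.
  rewrite -ep -ew in occ'; have := occ_pos_inj occ occ'; lia.
have [_] := leq_card_fsetU (fset_set (repeated_squares n%:Z)) [fset x in map f s]%fset.
rewrite dis => /eqP->; rewrite card_fseq undup_id // size_map size_filter.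
lia.
Qed.

Lemma square_atP z l :
  reflect (0 < l /\ agree z (z + l) l) (square_at trib (z + l + l) l).
Proof.
rewrite /square_at !addnK -addnA leq_addl andTb.
apply: (iffP andP) => -[l0 ag]; split=> //.
  by move=> d dl; apply/eqP/(allP ag); rewrite mem_iota.
by apply/allP => d; rewrite mem_iota add0n => /andP[_ dl]; apply/eqP/ag.
Qed.

(** The mismatch at i + n falls within the compared halves unless z + l <= i + n. *)
Lemma maxrun_square i n l z : maxrun i n l -> 0 < l -> i <= z <= i + n ->
  square_at trib (z + l + l) l = (z + l <= i + n).
Proof.
move=> [ag br _] l0 /andP[iz zn]; apply/square_atP/idP => [[_ sq]|le].
  rewrite leqNgt; apply/negP => lt; apply: br.
  have := sq (i + n - z) ltac:(lia).
  by rewrite subnKC // => ->; congr trib; lia.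
split=> // d dl; have := ag (z - i + d) ltac:(lia).
by rewrite addnA subnKC // => ->; congr trib; lia.
Qed.

(** * Squares ending at t_M + n that start before t_M *)

Ltac early_runs_case :=
  rewrite !inE => /or4P[/eqP[]|/eqP[]|/eqP[]|/orP[] /eqP[]]; lia.

(** A square is a near square, hence starts in a listed run, where squares of its period end exactly
    from i + 2l to i + l + n. The strict bound on [N] says that the start N - 2l, counted from 0,
    precedes t_M. *)
Lemma early_squares q N l : 1 < q ->
  tlen q.+3 + plen q <= N <= tlen q.+3 + plen q.+3 ->
  square_at trib N l && (N < tlen q.+3 + l + l) <->
  exists i n, (i, n, l) \in early_runs q /\
    i + l + l <= N <= i + l + n /\ N < tlen q.+3 + l + l.
Proof.
move=> q1 /andP[lo hi]; split=> [/andP[sq lt]|].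
  have lN : l + l <= N by case/and3P: sq.
  have NE : N = N - l - l + l + l by lia.
  have zt : N - l - l < tlen q.+3 by lia.
  move: sq; rewrite NE => /[dup] sq /square_atP [l0 ag].
  have ag' : agree (N - l - l) (N - l - l + l) l.-1.
    by move=> d dl; apply: ag; lia.
  have [|i [n [mem iz]]] := early_near_squares q1 zt _ ag'; first by lia.
  exists i, n; have := maxrun_square (early_runs_maxrun q1 mem) l0 iz.
  by rewrite sq => /esym le; split=> //; lia.
case=> i [n [mem [/andP[lo' hi'] lt]]]; rewrite lt andbT.
have l0 : 0 < l.
  have := tlen_bounds q; have := tlen_bounds q.+1; have := tlen_bounds q.+2.
  by move: mem; early_runs_case.
have -> : N = N - l - l + l + l by lia.
rewrite (maxrun_square (early_runs_maxrun q1 mem) l0); lia.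
Qed.

Lemma square_at_lt81 n l : n <= 81 ->
  square_at trib n l = square_at (nth La (T 7%:Z)) n l.
Proof.
move=> n81; rewrite /square_at; case: ltnP => //= l0; case: leqP => //= ln.
by apply: eq_in_all => d; rewrite mem_iota => dl; rewrite !trib_lt81 //; lia.
Qed.

Lemma tlen_facts p :
  [/\ 0 < tlen p <= tlen p.+1, tlen p.+1 <= tlen p.+2 <= 2 * tlen p.+1,
      tlen p.+3 = tlen p.+2 + tlen p.+1 + tlen p,
      tlen p.+4 = tlen p.+3 + tlen p.+2 + tlen p.+1 &
      tlen p.+4.+1 = tlen p.+4 + tlen p.+3 + tlen p.+2] /\
  [/\ 2 * plen p.+2 + 3 + tlen p.+2 = tlen p.+4,
      plen p.+3 = plen p.+2 + tlen p.+2, plen p.+4 = plen p.+3 + tlen p.+3 &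
      plen p.+4.+1 = plen p.+4 + tlen p.+4].
Proof.
have [? ?] := tlen_bounds p; have [/andP[_ ?] ?] := tlen_bounds p.+1.
by split; split; rewrite ?plen_tlen -?tlenSSS -?plenS //; apply/andP.
Qed.

(** Settles by computation the levels q <= 1 left out by [early_squares]. *)
Lemma early_squares_small T l0 lo hi (c : nat -> bool) :
  T + hi < 81 -> l0 < 81 ->
  all (fun n => all (fun l => square_at (nth La (Defs.T 7%:Z)) (T + n) l &&
    (n < l + l) == (l == l0) && c n) (iota 0 81)) (iota lo.+1 (hi - lo)) ->
  forall n l, lo < n <= hi ->
  square_at trib (T + n) l && (n < l + l) = (l == l0) && c n.
Proof.
move=> T81 l081 /allP H n l nb; rewrite square_at_lt81; last by lia.
have [l81|l81] := ltnP l 81.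
  have /allP/(_ l) := H n ltac:(rewrite mem_iota; lia).
  by rewrite mem_iota l81 => /(_ isT)/eqP.
have -> : (l == l0) = false by lia.
by apply/negP => /andP[/and3P[]]; lia.
Qed.

(** Past t_M + P_{M-1} only the first run is left; its first square ends at 2 t_M, that is, n =
    t_M. *)
Lemma early_squares_W q n l : plen q.+2 < n <= plen q.+3 ->
  square_at trib (tlen q.+3 + n) l && (n < l + l) =
  (l == tlen q.+3) && (tlen q.+3 <= n).
Proof.
case: q => [|[|p]] nb.
- by move: n l nb; apply: early_squares_small; vm_compute.
- by move: n l nb; apply: early_squares_small; vm_compute.
have [[? ? ? ? ?] [? ? ? ?]] := tlen_facts p.
have <- : (tlen p.+4.+1 + n < tlen p.+4.+1 + l + l) = (n < l + l) by lia.
apply/idP/idP => [/early_squares[]//|]; first by lia.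
  by move=> i [m []]; early_runs_case.
move=> /andP[/eqP -> tn]; apply/early_squares => //; first by lia.
by exists 0, (plen p.+4.+1); rewrite inE eqxx; split=> //; lia.
Qed.

(** Only the fourth run counts. It starts one period before t_M, so its first square has n = l. *)
Lemma early_squares_V q n l : 0 < q -> plen q.+1 < n <= plen q.+2 ->
  square_at trib (tlen q.+3 + n) l && (n < l + l) =
  (l == tlen q.+1 + tlen q) && (tlen q.+1 + tlen q <= n).
Proof.
case: q => [|[|p]] // _ nb.
  by move: n l nb; apply: early_squares_small; vm_compute.
have [[? ? ? ? ?] [? ? ? ?]] := tlen_facts p.
have <- : (tlen p.+4.+1 + n < tlen p.+4.+1 + l + l) = (n < l + l) by lia.
apply/idP/idP => [/early_squares[]//|]; first by lia.
  by move=> i [m []]; early_runs_case.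
move=> /andP[/eqP -> tn]; apply/early_squares => //; first by lia.
by exists (tlen p.+4), (plen p.+4); rewrite !inE eqxx !orbT; split=> //; lia.
Qed.

(** Only the fifth run counts. It covers the window, and the cut is where the start of the square
    reaches t_M. *)
Lemma early_squares_U q n l : 1 < q -> plen q < n <= plen q.+1 ->
  square_at trib (tlen q.+3 + n) l && (n < l + l) =
  (l == tlen q) && (n < tlen q + tlen q).
Proof.
case: q => [|[|p]] // _ nb.
have [[? ? ? ? ?] [? ? ? ?]] := tlen_facts p.
have <- : (tlen p.+4.+1 + n < tlen p.+4.+1 + l + l) = (n < l + l) by lia.
apply/idP/idP => [/early_squares[]//|]; first by lia.
  by move=> i [m []]; early_runs_case.
move=> /andP[/eqP -> tn]; apply/early_squares => //; first by lia.
exists (tlen p.+4 + tlen p.+3), (plen p.+3).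
by rewrite !inE eqxx !orbT; split=> //; lia.
Qed.

(** * Translation of [b] by t_M and the three identities *)

Lemma square_at_tlen_add M n l : n <= plen M ->
  square_at trib (tlen M + n) l && (l + l <= n) = square_at trib n l.
Proof.
move=> nP; rewrite /square_at; case: (ltnP 0 l) => //= l0.
case: (leqP (l + l) n) => ln; last by rewrite andbF.
rewrite andbT; have -> /= : l + l <= tlen M + n by lia.
apply: eq_in_all => d; rewrite mem_iota => dl.
have -> : tlen M + n - l - l + d = tlen M + (n - l - l + d) by lia.
have -> : tlen M + n - l + d = tlen M + (n - l + d) by lia.
by rewrite !trib_tlen_add; lia.
Qed.

Lemma b_shift M n l0 (c : bool) : 0 < n <= plen M ->
  (forall l, square_at trib (tlen M + n) l && (n < l + l) = (l == l0) && c) ->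
  b (tlen M + n)%N%:Z = (b n%:Z + c%:Z)%R.
Proof.
move=> /andP[n0 nP] early; rewrite !b_count ?addn_gt0 ?n0 ?orbT // -PoszD.
congr Posz; set N := tlen M + n.
pose new := [pred l | (l == l0) && c].
have eqN : square_at trib N =1 predU (square_at trib n) new.
  move=> l; rewrite /= -early -(square_at_tlen_add l nP) -andb_orr.
  by case: leqP => _; rewrite andbT.
have dis : predI (square_at trib n) new =1 pred0.
  move=> l; rewrite /= -early -(square_at_tlen_add l nP).
  by case: leqP; rewrite ?andbF.
rewrite (eq_count eqN); have := count_predUI (square_at trib n) new (iota 1 N).
rewrite (eq_count dis) count_pred0 addn0 => ->; congr (_ + _).
  (* The periods between n and N add nothing, since a square ending at n has period at most n. *)
  rewrite /N addnC iotaD count_cat -[RHS]addn0; congr (_ + _).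
  apply/eqP; rewrite -leqn0 leqNgt -has_count; apply/hasPn => l.
  by rewrite mem_iota => ln; apply/negP => /and3P[]; lia.
case: c @new early {eqN dis} => new early; last first.
  by rewrite (@eq_count _ _ pred0) ?count_pred0 // => l; rewrite /= andbF.
rewrite (@eq_count _ _ (pred1 l0)) => [|l]; last by rewrite /= andbT.
rewrite count_uniq_mem ?iota_uniq // mem_iota; congr nat_of_bool.
by have := early l0; rewrite eqxx => /andP[/and3P[? ? _] _]; lia.
Qed.

Lemma b_vec_shift (k p q a a' : nat) (x x' : int) :
  (forall i, i < k -> b (q + i.+1)%N%:Z =
     (b (p + i.+1)%N%:Z + (if (i < a)%N then x else x'))%R) -> a + a' = k ->
  (bvec (shift (Defs.interval 1 k%:Z) q%:Z) =
   vadd (bvec (shift (Defs.interval 1 k%:Z) p%:Z)) (nseq a x ++ nseq a' x'))%R.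
Proof.
move=> H ak; rewrite !shift_interval /bvec /vadd -!map_comp.
have sz : size (nseq a x ++ nseq a' x') = k by rewrite size_cat !size_nseq.
apply: (@eq_from_nth _ 0%R).
  by rewrite !size_map size1_zip ?size_map ?sz ?size_iota.
move=> i; rewrite size_map size_iota => ik.
rewrite (nth_map 0) ?size_iota // nth_iota // add0n /=.
rewrite (nth_map (0%R, 0%R)); last by rewrite size_zip size_map sz size_iota minnn.
rewrite nth_zip ?size_map ?size_iota ?sz //=.
rewrite (nth_map 0) ?size_iota // nth_iota // add0n /=.
rewrite nth_cat size_nseq !nth_nseq.
have -> : (q%:Z + 1 + i%:Z = (q + i.+1)%N%:Z)%R by lia.
have -> : (p%:Z + 1 + i%:Z = (p + i.+1)%N%:Z)%R by lia.
rewrite H //; congr (_ + _)%R; case: ltnP => // ai.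
by have -> : i - a < a' by lia.
Qed.

Lemma b_small n : 0 < n <= 7 -> b n%:Z = 0%R.
Proof.
move=> nb; rewrite b_count; last by lia.
rewrite (@eq_in_count _ _ (square_at (nth La (T 7%:Z)) n)); last first.
  by move=> l _; rewrite square_at_lt81; lia.
have /allP/(_ n) : all (fun n => count (square_at (nth La (T 7%:Z)) n) (iota 1 n) == 0)
  (iota 1 7) by vm_compute.
by rewrite mem_iota => /(_ ltac:(lia))/eqP->.
Qed.

Local Open Scope ring_scope.

Theorem propositionb :
  (forall n : int, 1 <= n -> n <= 7 -> b n = 0) /\
  (forall m : int, 3 <= m ->
    [/\ bvec (U (m + 2)) =
          vadd (bvec (UVW (m - 1)))
            (rep ((- t (m + 1) + 5 * t (m - 1) + 1) %/ 2)%Z 1 ++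
             rep ((t (m + 1) - 3 * t (m - 1) - 1) %/ 2)%Z 0),
        bvec (V (m + 1)) =
          vadd (bvec (UVW (m - 1)))
            (rep ((t (m - 1) - t (m - 3) + 1) %/ 2)%Z 0 ++
             rep ((t (m - 1) + t (m - 3) - 1) %/ 2)%Z 1)
      & bvec (W m) =
          vadd (bvec (UVW (m - 1)))
            (rep ((t (m - 1) + t (m - 3) + 1) %/ 2)%Z 0 ++
             rep ((t (m - 1) - t (m - 3) - 1) %/ 2)%Z 1)]).
Proof.
split=> [[] // n n1 n7|m m3]; first by apply: b_small; lia.
(* With q = m - 3 every index in the statement becomes natural. *)
have [q mE] : exists q : nat, m = q.+3%:Z by exists `|m - 3|%N; lia.
subst m; clear m3.
have [[? ? ? ? ?] [? ? ? ?]] := tlen_facts q.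
have [? ? _] : [/\ tlen q.+1 <= 2 * tlen q, 0 < tlen q & True]%N.
  by have [/andP[]] := tlen_bounds q.
have E (m : int) (n : nat) : m = n%:Z -> t m = (tlen n)%:Z by move=> ->.
have tm4 := E (q.+3%:Z + 1) q.+4 ltac:(lia).
have tm2 := E (q.+3%:Z - 1) q.+2 ltac:(lia).
have tm1 := E (q.+3%:Z - 2) q.+1 ltac:(lia).
have tm0 := E (q.+3%:Z - 3) q ltac:(lia).
have UVWE : UVW (q.+3%:Z - 1) =
    shift (Defs.interval 1 (tlen q.+2)%:Z) (plen q.+2)%:Z.
  rewrite UVW_interval; last by lia.
  rewrite tm2 (E _ q.+3) ?(E _ q.+1); try lia.
  by congr shift; lia.
rewrite /rep UVWE tm4 tm2 tm0; split.
- have -> : U (q.+3%:Z + 2) =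
      shift (Defs.interval 1 (tlen q.+2)%:Z) (plen q.+4.+1)%:Z.
    rewrite /U (E (_ - 3) q.+2) ?(E (_ + 1) q.+4.+2) ?(E (_ - 1) q.+4); try lia.
    by have ? := tlenSSS q.+3; congr shift; lia.
  apply: b_vec_shift => [i ik|]; last by lia.
  (* P_{m+2} = t_{m+2} + P_{m-1}: the block is the window (P_{m-1}, P_m] translated by t_{m+2}. The
     other two blocks are its translates by t_{m+1} and t_m. *)
  have -> : (plen q.+4.+1 + i.+1 = tlen q.+4.+1 + (plen q.+2 + i.+1))%N by lia.
  (* The number of ones is 2 t_{m-1} - P_{m-1} - 1, the number of n > P_{m-1} with n < 2 t_{m-1}. *)
  rewrite (@b_shift _ _ (tlen q.+2) (plen q.+2 + i.+1 < tlen q.+2 + tlen q.+2)%N).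
  + by congr (_ + _); case: ifP; lia.
  + by lia.
  + by move=> l; apply: early_squares_U; lia.
- have -> : V (q.+3%:Z + 1) =
      shift (Defs.interval 1 (tlen q.+2)%:Z) (plen q.+4 + tlen q.+1)%:Z.
    rewrite /V (E (_ - 2) q.+2) ?(E (_ + 1) q.+4); try lia.
    by congr shift; lia.
  apply: b_vec_shift => [i ik|]; last by lia.
  have -> : (plen q.+4 + tlen q.+1 + i.+1 = tlen q.+4 + (plen q.+2 + i.+1))%N.
    by lia.
  rewrite (@b_shift _ _ (tlen q.+2 + tlen q.+1)
    (tlen q.+2 + tlen q.+1 <= plen q.+2 + i.+1)%N).
  + by congr (_ + _); case: ifP; lia.
  + by lia.
  + by move=> l; apply: early_squares_V; lia.
- have -> : W q.+3%:Z =
      shift (Defs.interval 1 (tlen q.+2)%:Z) (plen q.+3 + tlen q + tlen q.+1)%:Z.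
    rewrite /W tm2 tm1 (E _ q.+3); try lia.
    by congr shift; lia.
  apply: b_vec_shift => [i ik|]; last by lia.
  have -> : (plen q.+3 + tlen q + tlen q.+1 + i.+1 =
      tlen q.+3 + (plen q.+2 + i.+1))%N by lia.
  rewrite (@b_shift _ _ (tlen q.+3) (tlen q.+3 <= plen q.+2 + i.+1)%N).
  + by congr (_ + _); case: ifP; lia.
  + by lia.
  + by move=> l; apply: early_squares_W; lia.
Qed.
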